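(* There is an absolute constant $C>0$ such that for every prime $p$ there exists a Latin trade $T$ in $B_p$ with $|T|\le C\log p$ such that every symbol of $\mathbb{Z}_p$ occurs in $T$ either exactly twice or not at all.
   Context: A Latin square of order $p$ is viewed as a set of (row, column, symbol) triples in $\mathbb{Z}_p^3$. $B_p$ is the addition table of $\mathbb{Z}_p$: the Latin square with symbol $i+j \pmod p$ in cell $(i,j)$, $i,j\in\mathbb{Z}_p$. A Latin trade in a Latin square $L$ is a subset $T\subseteq L$ for which there is a partial Latin square $T'$ (a disjoint mate) such that $T$ and $T'$ occupy the same set of cells, $T\cap T'=\emptyset$, and each row (respectively column) of $T$ contains the same set of symbols as the corresponding row (column) of $T'$. $|T|$ is the number of triples in $T$. *)

(* Defs.v *)
From mathcomp Require Import all_boot.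
From Stdlib Require Import Reals.

Set Implicit Arguments.
Unset Strict Implicit.
Unset Printing Implicit Defensive.

(* Z_p is represented by 'I_p (residues 0..p-1); a triple is
   ((row, column), symbol). *)
Definition triple (p : nat) : finType := ('I_p * 'I_p * 'I_p)%type.

Definition trow {p} (t : triple p) : 'I_p := t.1.1.
Definition tcol {p} (t : triple p) : 'I_p := t.1.2.
Definition tsym {p} (t : triple p) : 'I_p := t.2.
Definition tcell {p} (t : triple p) : 'I_p * 'I_p := t.1.

Definition Bp (p : nat) : {set triple p} :=
  [set t : triple p | val (tsym t) == (val (trow t) + val (tcol t)) %% p].

Definition partial_latin {p} (P : {set triple p}) : Prop :=
  forall x y, x \in P -> y \in P ->
    ((trow x = trow y /\ tcol x = tcol y) -> x = y) /\
    ((trow x = trow y /\ tsym x = tsym y) -> x = y) /\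
    ((tcol x = tcol y /\ tsym x = tsym y) -> x = y).

Definition row_syms {p} (P : {set triple p}) (r : 'I_p) : {set 'I_p} :=
  [set tsym t | t in P & trow t == r].
Definition col_syms {p} (P : {set triple p}) (c : 'I_p) : {set 'I_p} :=
  [set tsym t | t in P & tcol t == c].
Definition cells {p} (P : {set triple p}) : {set 'I_p * 'I_p} :=
  [set tcell t | t in P].

Definition disjoint_mate {p} (T T' : {set triple p}) : Prop :=
  partial_latin T' /\ cells T = cells T' /\ T :&: T' = set0 /\
  (forall r, row_syms T r = row_syms T' r) /\
  (forall c, col_syms T c = col_syms T' c).

Definition latin_trade {p} (L T : {set triple p}) : Prop :=
  T != set0 /\ T \subset L /\ exists T' : {set triple p}, disjoint_mate T T'.

Definition sym_count {p} (T : {set triple p}) (s : 'I_p) : nat :=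
  #|[set t in T | tsym t == s]|.

(* Main.v *)
(* Dissect a [w x h] rectangle with [w + h = p] into squares such that the numbers
   [x + y + d] (lower left corner [(x, y)], side [d]) are pairwise distinct.  In every
   square put the symbol [x + y + d] on the two corners where the addition table has it;
   the mate moves it to the other two corners.  At each point the corners of the squares
   cancel, except at the corners of the outer rectangle, which are those of one more
   "square" for the symbol [0], since [w + h = 0] modulo [p].

   To use only O(log p) squares, start from the rectangle [e x (4^m - e)], double it and
   add three squares: this gives [e' x (4^(m+1) - e')] with [e' = e + d 4^m] for [d] equal
   to 1 or 2.  Adding one square yields [e x 4^m] for every [e] whose base 4 digits are 1
   or 2.  Three such columns side by side have total width an arbitrary number modulo
   [4^m] (up to parity), because a sum of three digits takes all values in 3, 4, 5, 6.
   Squares of side [4^m] between the columns keep the values [x + y + d] apart. *)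
Require Import Defs.
From mathcomp Require Import all_boot zify.
From Stdlib Require Import Reals Lra.

Set Implicit Arguments.
Unset Strict Implicit.
Unset Printing Implicit Defensive.

(* [Reals] rebinds this notation to [Nat.pow]. *)
Local Notation "m ^ n" := (expn m n) : nat_scope.

(** * Dissections of rectangles into squares *)

Definition square : Type := (nat * nat * nat)%type.

Definition antidiag (q : square) : nat := q.1.1 + q.1.2 + q.2.

Definition anti_corners (f : nat -> nat -> nat) (q : square) : nat :=
  f q.1.1 (q.1.2 + q.2) + f (q.1.1 + q.2) q.1.2.
Definition main_corners (f : nat -> nat -> nat) (q : square) : nat :=
  f q.1.1 q.1.2 + f (q.1.1 + q.2) (q.1.2 + q.2).

(* Only what the trade needs of a dissection: the signed corners of the squares add up to
   those of the rectangle, tested against all [f]. *)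
Definition tiles (L : seq square) (w h : nat) : Prop :=
  forall f, \sum_(q <- L) anti_corners f q + (f 0 0 + f w h) =
            \sum_(q <- L) main_corners f q + (f 0 h + f w 0).

(** Positive sides keep the corners of a square distinct and the antidiagonals off [0]; the bound
    [w + h], the later modulus, keeps them distinct as residues. *)
Definition dissection (n w h : nat) : Prop :=
  exists L : seq square,
    [/\ size L <= n, tiles L w h, all (fun q => 0 < q.2) L,
        uniq (map antidiag L) & all (fun q => antidiag q < w + h) L].

Lemma dissection_leq n n' w h :
  n <= n' -> dissection n w h -> dissection n' w h.
Proof.
by move=> le_nn' [L [szL tL pL uL bL]]; exists L; split=> //; apply: leq_trans le_nn'.
Qed.

Lemma dissection_unit : dissection 1 1 1.
Proof.
exists [:: (0, 0, 1)]; split=> // f.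
by rewrite !big_seq1 /anti_corners /main_corners /= !add0n addnC [f 0 1 + _]addnC; lia.
Qed.

Lemma dissection_transpose n w h : dissection n w h -> dissection n h w.
Proof.
move=> [L [szL tL pL uL bL]].
pose tr (q : square) : square := (q.1.2, q.1.1, q.2).
have diag_tr q : antidiag (tr q) = antidiag q by rewrite /antidiag /=; lia.
exists (map tr L); split; first by rewrite size_map.
- move=> f; rewrite !big_map.
  pose g x y := f y x.
  have tLg : \sum_(q <- L) anti_corners g q + (f 0 0 + f h w) =
    \sum_(q <- L) main_corners g q + (f h 0 + f 0 w) := tL g.
  have anti_tr q : anti_corners f (tr q) = anti_corners g q by apply: addnC.
  have main_tr q : main_corners f (tr q) = main_corners g q by [].
  rewrite (eq_bigr _ (fun q _ => anti_tr q)) (eq_bigr _ (fun q _ => main_tr q)).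
  by lia.
- by rewrite all_map.
- by rewrite -map_comp (eq_map diag_tr).
- by rewrite all_map; apply: sub_all bL => q /=; rewrite diag_tr addnC.
Qed.

(** The separating square has antidiagonal [w1 + h]. Those on its left are smaller; those on its
    right are larger, being positive numbers shifted by [w1 + h]. *)
Lemma dissection_juxtapose n1 n2 w1 w2 h :
  0 < h -> dissection n1 w1 h -> dissection n2 w2 h ->
  dissection (n1 + n2).+1 (w1 + h + w2) h.
Proof.
move=> h_gt0 [L1 [sz1 t1 p1 u1 b1]] [L2 [sz2 t2 p2 u2 b2]].
pose sh (q : square) : square := (w1 + h + q.1.1, q.1.2, q.2).
have diag_sh q : antidiag (sh q) = w1 + h + antidiag q by rewrite /antidiag /= !addnA.
exists ((w1, 0, h) :: L1 ++ map sh L2); split.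
- by rewrite /= size_cat size_map ltnS leq_add.
- move=> f; rewrite !big_cons !big_cat !big_map /=.
  pose g x y := f (w1 + h + x) y; have t1f := t1 f.
  have t2g : \sum_(q <- L2) anti_corners g q + (f (w1 + h + 0) 0 + f (w1 + h + w2) h) =
    \sum_(q <- L2) main_corners g q + (f (w1 + h + 0) h + f (w1 + h + w2) 0) := t2 g.
  have anti_sh q : anti_corners f (sh q) = anti_corners g q.
    by rewrite /anti_corners /g !addnA.
  have main_sh q : main_corners f (sh q) = main_corners g q.
    by rewrite /main_corners /g !addnA.
  rewrite (eq_bigr _ (fun q _ => anti_sh q)) (eq_bigr _ (fun q _ => main_sh q)).
  rewrite !addn0 in t2g.
  rewrite /(anti_corners _ (_, _, _)) /(main_corners _ (_, _, _)) /= !add0n.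
  by lia.
- by rewrite /= h_gt0 all_cat p1 all_map.
- rewrite /= map_cat mem_cat cat_uniq u1 -map_comp (eq_map diag_sh) /=.
  rewrite (map_comp (addn (w1 + h))) (map_inj_uniq (@addnI _)) u2 andbT.
  have inL1 q : q \in L1 -> antidiag q < w1 + h by move/(allP b1).
  apply/andP; split; last first.
    apply/hasPn=> _ /mapP[s _ ->]; apply/negP=> /mapP[q /inL1] /=; lia.
  rewrite negb_or; apply/andP; split; apply/negP=> /mapP[q].
    by move/inL1; rewrite {2}/antidiag /=; lia.
  by case/mapP=> r /(allP p2) r_gt0 ->; rewrite /antidiag /=; lia.
- rewrite /= all_cat all_map; apply/and3P; split; first by rewrite /antidiag /=; lia.
    by apply: sub_all b1 => q /=; lia.
  by apply: sub_all b2 => q /=; rewrite diag_sh; lia.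
Qed.

Lemma dissection_add_square n w h :
  0 < h -> dissection n w h -> dissection n.+1 (w + h) h.
Proof.
move=> h_gt0 Dwh; rewrite -[w + h]addn0 -[n]addn0.
apply: dissection_juxtapose => //.
by exists [::]; split=> // f; rewrite !big_nil !add0n addnC.
Qed.

Lemma dissection_add_squares k n w h :
  0 < h -> dissection n w h -> dissection (k + n) (k * h + w) h.
Proof.
move=> h_gt0 Dwh; elim: k => [|k IHk]; first by rewrite mul0n.
by rewrite addSn mulSnr addnAC; apply: dissection_add_square.
Qed.

(* After doubling, all old antidiagonals are even and below [2w + 2h], so that the new
   one at [w + 2h], which is odd, is not among them. *)
Lemma dissection_double n w h :
  odd w -> dissection n w h -> dissection (n + 3) (3 * w + 2 * h) (w + 2 * h).
Proof.
move=> w_odd [L [szL tL pL uL bL]].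
pose dbl (q : square) : square := (2 * q.1.1, 2 * q.1.2, 2 * q.2).
have diag_dbl q : antidiag (dbl q) = 2 * antidiag q by rewrite /antidiag /=; lia.
have w_gt0 : 0 < w by case: (w) w_odd.
(* Two squares of side [w] on top raise the doubled rectangle to height [w + 2 * h]; a square of
   that height then goes on its right. *)
exists ([:: (0, 2 * h, w); (w, 2 * h, w); (2 * w, 0, w + 2 * h)] ++ map dbl L); split.
- by rewrite /= size_map; lia.
- move=> f; rewrite !big_cons !big_map.
  pose g x y := f (2 * x) (2 * y).
  have tLg : \sum_(q <- L) anti_corners g q + (f 0 0 + f (2 * w) (2 * h)) =
    \sum_(q <- L) main_corners g q + (f 0 (2 * h) + f (2 * w) 0) := tL g.
  have anti_dbl q : anti_corners f (dbl q) = anti_corners g q.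
    by rewrite /anti_corners /g !mulnDr.
  have main_dbl q : main_corners f (dbl q) = main_corners g q.
    by rewrite /main_corners /g !mulnDr.
  rewrite (eq_bigr _ (fun q _ => anti_dbl q)) (eq_bigr _ (fun q _ => main_dbl q)).
  rewrite {1 2 3}/anti_corners {1 2 3}/main_corners /= !add0n.
  have -> : 2 * h + w = w + 2 * h by lia.
  have -> : w + w = 2 * w by lia.
  have -> : 2 * w + (w + 2 * h) = 3 * w + 2 * h by lia.
  by lia.
- by rewrite all_cat all_map /= !w_gt0 ltn_addr //; apply: sub_all pL => q /=; lia.
- rewrite map_cat -map_comp (eq_map diag_dbl) cat_uniq.
  have mul2_inj : injective (muln 2) by move=> a b; lia.
  rewrite (map_comp (muln 2)) (map_inj_uniq mul2_inj) uL andbT.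
  apply/andP; split.
    by rewrite /= !inE /antidiag /=; lia.
  apply/hasPn=> _ /mapP[_ /mapP[q /(allP bL) ltq ->] ->].
  move: (antidiag q) ltq => a lt_a; rewrite /= !inE /antidiag /=.
  by lia.
- rewrite all_cat all_map; apply/andP; split; first by rewrite /= /antidiag /=; lia.
  by apply: sub_all bL => q /=; rewrite diag_dbl; lia.
Qed.

(** * Rectangles with logarithmically many squares *)

Definition ladder (m e : nat) : Prop :=
  [/\ odd e, e < 4 ^ m & dissection (3 * m) e (4 ^ m - e)].

(** With [b = 4 ^ m], doubling [e x (b - e)] gives [(e + 2b) x (2b - e)], and doubling its transpose
    gives [(3b - e) x (e + b)]: digits [2] and [1]. Both sides are odd, as doubling requires. *)
Lemma ladder_step m e d :
  0 < m -> 0 < d < 3 -> ladder m e -> ladder m.+1 (e + d * 4 ^ m).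
Proof.
move=> m_gt0 d12 [e_odd lt_e De].
have b_even : odd (4 ^ m) = false by rewrite oddX; case: (m) m_gt0.
have h_odd : odd (4 ^ m - e) by rewrite oddB ?b_even ?e_odd // ltnW.
have bS : 4 ^ m.+1 = 4 * 4 ^ m by rewrite expnS.
split; first by rewrite oddD oddM b_even andbF addbF.
  by rewrite bS; case: d d12 => [|[|[|d]]] //; lia.
have -> : 3 * m.+1 = 3 * m + 3 by lia.
have [-> | ->] : d = 1 \/ d = 2 by lia.
  have := dissection_double h_odd (dissection_transpose De).
  move/dissection_transpose; congr dissection; lia.
by have := dissection_double e_odd De; congr dissection; lia.
Qed.

Lemma ladder_base e : e = 1 \/ e = 3 -> ladder 1 e.
Proof.
have D31 := dissection_add_squares 2 (isT : 0 < 1) dissection_unit.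
by case=> ->; split=> //; apply: dissection_transpose.
Qed.

(* The three leading digits lie in {1, 2}; their sums 3, 4, 5, 6 are a complete residue
   system modulo 4. *)
Lemma ladder_sum m N :
  odd N -> 3 * 4 ^ m.+1 <= N ->
  exists e1 e2 e3 k, [/\ ladder m.+1 e1, ladder m.+1 e2, ladder m.+1 e3 &
                        N = e1 + e2 + e3 + k * 4 ^ m.+1].
Proof.
elim: m => [|m IHm] N_odd le_N.
  (* Modulo 4, [1 + 2] and [3 + 2] cover both odd residues. *)
  have [e e13 [k Nk]] : exists2 e, e = 1 \/ e = 3 & exists k, N = e + 2 + 4 * k.
    have [r4|r4] : N %% 4 = 1 \/ N %% 4 = 3 by lia.
      by exists 3; [right | exists (N %/ 4 - 1); lia].
    by exists 1; [left | exists (N %/ 4); lia].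
  exists e, 1, 1, k; split; try exact: ladder_base (or_introl _ erefl).
    exact: ladder_base.
  by rewrite Nk; lia.
have bS : 4 ^ m.+2 = 4 * 4 ^ m.+1 by rewrite expnS.
have [||e1 [e2 [e3 [k [l1 l2 l3 Nk]]]]] := IHm => //; first by lia.
have [_ lt1 _] := l1; have [_ lt2 _] := l2; have [_ lt3 _] := l3.
(* [6] is the largest digit sum, so [k'] below is natural. Here [N] is at least [12 * 4 ^ m.+1], and
   [e1 + e2 + e3] is less than [3 * 4 ^ m.+1]. *)
have k_ge6 : 6 <= k.
  by rewrite leqNgt; apply/negP=> k_lt6; have : k * 4 ^ m.+1 <= 5 * 4 ^ m.+1;
     [rewrite leq_mul2r; lia | lia].
have [d1 [d2 [d3 [k' [b1 b2 b3 kE]]]]] : exists d1 d2 d3 k',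
    [/\ 0 < d1 < 3, 0 < d2 < 3, 0 < d3 < 3 & k = d1 + d2 + d3 + 4 * k'].
  have [r|[r|[r|r]]] : k %% 4 = 3 \/ k %% 4 = 0 \/ k %% 4 = 1 \/ k %% 4 = 2 by lia.
  - by exists 1, 1, 1, ((k - 3) %/ 4); split=> //; lia.
  - by exists 2, 1, 1, ((k - 4) %/ 4); split=> //; lia.
  - by exists 2, 2, 1, ((k - 5) %/ 4); split=> //; lia.
  - by exists 2, 2, 2, ((k - 6) %/ 4); split=> //; lia.
exists (e1 + d1 * 4 ^ m.+1), (e2 + d2 * 4 ^ m.+1), (e3 + d3 * 4 ^ m.+1), k'.
by split; try exact: ladder_step; rewrite Nk kE bS; lia.
Qed.

Lemma ladder_column m e : ladder m e -> dissection (3 * m).+1 e (4 ^ m).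
Proof.
move=> [e_odd lt_e De]; apply: dissection_transpose.
rewrite -(subnK (ltnW lt_e)); apply: dissection_add_square.
  by case: (e) e_odd.
exact: dissection_transpose.
Qed.

Lemma prime_dissection p :
  prime p -> exists m w h, [/\ 4 ^ m <= p, w + h = p, 0 < w, 0 < h &
                             dissection (9 * m + 28) w h].
Proof.
move=> p_pr; have p_gt1 := prime_gt1 p_pr.
have [p_lt24|p_ge24] := ltnP p 24.
  (* A strip of height [1] takes at most 22 unit squares. *)
  exists 0, p.-1, 1; split; try lia.
  have := dissection_add_squares p.-2 (isT : 0 < 1) dissection_unit.
  rewrite (_ : p.-2 * 1 + 1 = p.-1); last by lia.
  by apply: dissection_leq; lia.
have p_odd : odd p by case/even_prime: p_pr => // p2; rewrite p2 in p_ge24.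
have q_gt0 : 0 < p %/ 6 by lia.
(* The power [b] of 4 chosen here satisfies [6 * b <= p < 24 * b]. Of the six, three pay for two
   separating squares and the height, three for the hypothesis of [ladder_sum]; the upper bound
   yields [k < 24]. *)
have /andP[le_m lt_m] := @trunc_log_bounds 4 (p %/ 6) isT q_gt0.
have m_gt0 : 0 < trunc_log 4 (p %/ 6) by rewrite trunc_log_gt0; lia.
case: (trunc_log 4 (p %/ 6)) m_gt0 le_m lt_m => // m _ le_m lt_m.
have bS : 4 ^ m.+2 = 4 * 4 ^ m.+1 by rewrite expnS.
have b_even : odd (4 ^ m.+1) = false by rewrite oddX.
have b_gt0 : 0 < 4 ^ m.+1 by rewrite expn_gt0.
have N_odd : odd (p - 3 * 4 ^ m.+1).
  by rewrite oddB ?oddM ?b_even ?p_odd //; lia.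
have [|e1 [e2 [e3 [k [l1 l2 l3 Nk]]]]] := ladder_sum (m := m) N_odd; first by lia.
have k_lt24 : k < 24.
  by rewrite -(ltn_pmul2r b_gt0); lia.
have D12 := dissection_juxtapose b_gt0 (ladder_column l1)
  (ladder_column l2).
have D123 := dissection_juxtapose b_gt0 D12 (ladder_column l3).
have := dissection_add_squares k b_gt0 D123.
set w := (X in dissection _ X _) => Dw.
exists m.+1, w, (4 ^ m.+1); split=> //; rewrite /w; try lia.
(* Three columns cost [3 * (3 * m.+1 + 1)] squares, the gaps 2, the padding at most 23. *)
by apply: dissection_leq Dw; lia.
Qed.

(** * Latin trades made of blocks *)

Lemma Bp_cell_inj p : {in Bp p &, injective (@tcell p)}.
Proof.
move=> [[r c] s] [[r' c'] s']; rewrite !inE /tsym /trow /tcol /tcell /=.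
move=> /eqP Es /eqP Es' [rr cc]; rewrite rr cc in Es *.
by congr (_, _); apply: ord_inj; rewrite Es Es'.
Qed.

Lemma uniq_map_inj (T1 T2 : eqType) (f : T1 -> T2) (l : seq T1) :
  uniq (map f l) -> {in l &, injective f}.
Proof.
elim: l => //= a l IHl /andP[fa_notin /IHl inj_l] x y.
rewrite !inE => /predU1P[->|xl] /predU1P[->|yl] // fxy.
- by rewrite fxy map_f in fa_notin.
- by rewrite -fxy map_f in fa_notin.
- exact: inj_l.
Qed.

(* A block [q] carries the symbol [s q] in cells [(r1, c2)], [(r2, c1)] of the trade and in
   cells [(r1, c1)], [(r2, c2)] of its mate. *)
Section BlockTrade.

Variables (p : nat) (Q : eqType) (E : seq Q) (r1 r2 c1 c2 s : Q -> 'I_p).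

Definition block_trade : seq (triple p) :=
  [seq (r1 q, c2 q, s q) | q <- E] ++ [seq (r2 q, c1 q, s q) | q <- E].
Definition block_mate : seq (triple p) :=
  [seq (r1 q, c1 q, s q) | q <- E] ++ [seq (r2 q, c2 q, s q) | q <- E].

Hypothesis s_uniq : uniq (map s E).
Hypothesis r_neq : {in E, forall q, r1 q != r2 q}.
Hypothesis c_neq : {in E, forall q, c1 q != c2 q}.
Hypothesis block_Bp : {subset block_trade <= Bp p}.
Hypothesis same_cells : perm_eq (map tcell block_trade) (map tcell block_mate).

Let s_inj : {in E &, injective s}.
Proof. exact: uniq_map_inj s_uniq. Qed.

Lemma block_tradeP t :
  reflect (exists2 q, q \in E & t = (r1 q, c2 q, s q) \/ t = (r2 q, c1 q, s q))
          (t \in block_trade).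
Proof.
rewrite mem_cat; apply: (iffP orP) => [[]/mapP[q Eq ->]|[q Eq [] ->]].
- by exists q; [|left].
- by exists q; [|right].
- by left; apply: (map_f (fun q => (r1 q, c2 q, s q))).
- by right; apply: (map_f (fun q => (r2 q, c1 q, s q))).
Qed.

Lemma block_mateP t :
  reflect (exists2 q, q \in E & t = (r1 q, c1 q, s q) \/ t = (r2 q, c2 q, s q))
          (t \in block_mate).
Proof.
rewrite mem_cat; apply: (iffP orP) => [[]/mapP[q Eq ->]|[q Eq [] ->]].
- by exists q; [|left].
- by exists q; [|right].
- by left; apply: (map_f (fun q => (r1 q, c1 q, s q))).
- by right; apply: (map_f (fun q => (r2 q, c2 q, s q))).
Qed.

Lemma block_trade_uniq : uniq block_trade.
Proof.
rewrite cat_uniq !map_inj_in_uniq ?(map_uniq s_uniq) //=; first last.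
- by move=> q q' Eq Eq' [_ _]; apply: s_inj.
- by move=> q q' Eq Eq' [_ _]; apply: s_inj.
rewrite andbT; apply/hasPn=> _ /mapP[q Eq ->]; apply/negP=> /mapP[q' Eq' [rr _ ss]].
by move: (r_neq Eq); rewrite rr (s_inj Eq Eq' ss) eqxx.
Qed.

(** The cells of the mate rearrange those of the trade, which are distinct because its entries are
    and [Bp p] has one entry per cell. *)
Lemma swapped_cell_inj : {in block_mate &, injective (@tcell p)}.
Proof.
apply: uniq_map_inj; rewrite -(perm_uniq same_cells).
rewrite map_inj_in_uniq ?block_trade_uniq // => x y /block_Bp Bx /block_Bp By.
exact: Bp_cell_inj.
Qed.

Lemma block_latin_trade :
  E <> [::] -> latin_trade (Bp p) [set t in block_trade].
Proof.
move=> E_neq0; split; [|split].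
- case: E E_neq0 (block_tradeP) => // q E' _ symsP.
  apply/set0Pn; exists (r1 q, c2 q, s q); rewrite inE; apply/symsP.
  by exists q; [exact: mem_head | left].
- by apply/subsetP=> t; rewrite inE => /block_Bp.
exists [set t in block_mate]; split; [|split; [|split; [|split]]].
- move=> x y; rewrite !inE => Tx Ty; split; [|split].
  + by move=> [rr cc]; apply: swapped_cell_inj => //; move: x y rr cc {Tx Ty} =>
      [[? ?] ?] [[? ?] ?]; rewrite /trow /tcol /tcell /= => -> ->.
  (* Equal symbols mean equal blocks, and the mate has the symbol of a block in two different rows
     and columns. *)
  + case/block_mateP: Tx => q Eq; case/block_mateP: Ty => q' Eq'.
    case=> -> [] -> [/= rr ss]; have qq' := s_inj Eq Eq' ss; rewrite qq' // in rr *;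
    by case/eqP: (r_neq Eq').
  + case/block_mateP: Tx => q Eq; case/block_mateP: Ty => q' Eq'.
    case=> -> [] -> [/= cc ss]; have qq' := s_inj Eq Eq' ss; rewrite qq' // in cc *;
    by case/eqP: (c_neq Eq').
- apply/setP=> c; apply/imsetP/imsetP=> -[t]; rewrite inE => Tt ->.
    have : tcell t \in map tcell block_mate by rewrite -(perm_mem same_cells) map_f.
    by case/mapP=> u Tu ->; exists u; rewrite ?inE.
  have : tcell t \in map tcell block_trade by rewrite (perm_mem same_cells) map_f.
  by case/mapP=> u Tu ->; exists u; rewrite ?inE.
- apply/setP=> t; rewrite !inE; apply/negP=> /andP[/block_tradeP[q Eq tE]].
  case/block_mateP=> q' Eq' tE'.
  have ss : s q = s q' by case: tE tE' => -> [] [].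
  have qq' := s_inj Eq Eq' ss; subst q'.
  case: tE tE' => -> [] [].
  - by move/eqP; rewrite eq_sym (negPf (c_neq Eq)).
  - by move/eqP; rewrite (negPf (r_neq Eq)).
  - by move/eqP; rewrite eq_sym (negPf (r_neq Eq)).
  - by move/eqP; rewrite (negPf (c_neq Eq)).
(* Each row or column of a block loses its symbol at one corner and regains it at the other. *)
- move=> r; apply/setP=> a; apply/imsetP/imsetP=> -[t]; rewrite !inE => /andP[].
    case/block_tradeP=> q Eq [] -> rq ->.
      exists (r1 q, c1 q, s q) => //; rewrite !inE rq andbT; apply/block_mateP.
      by exists q => //; left.
    exists (r2 q, c2 q, s q) => //; rewrite !inE rq andbT; apply/block_mateP.
    by exists q => //; right.
  case/block_mateP=> q Eq [] -> rq ->.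
    exists (r1 q, c2 q, s q) => //; rewrite !inE rq andbT; apply/block_tradeP.
    by exists q => //; left.
  exists (r2 q, c1 q, s q) => //; rewrite !inE rq andbT; apply/block_tradeP.
  by exists q => //; right.
- move=> r; apply/setP=> a; apply/imsetP/imsetP=> -[t]; rewrite !inE => /andP[].
    case/block_tradeP=> q Eq [] -> cq ->.
      exists (r2 q, c2 q, s q) => //; rewrite !inE cq andbT; apply/block_mateP.
      by exists q => //; right.
    exists (r1 q, c1 q, s q) => //; rewrite !inE cq andbT; apply/block_mateP.
    by exists q => //; left.
  case/block_mateP=> q Eq [] -> cq ->.
    exists (r2 q, c1 q, s q) => //; rewrite !inE cq andbT; apply/block_tradeP.
    by exists q => //; right.
  exists (r1 q, c2 q, s q) => //; rewrite !inE cq andbT; apply/block_tradeP.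
  by exists q => //; left.
Qed.

Lemma block_card : #|[set t in block_trade]| <= 2 * size E.
Proof.
by rewrite cardsE (leq_trans (card_size _)) // size_cat !size_map addnn mul2n.
Qed.

Lemma block_sym_count a :
  sym_count [set t in block_trade] a = 2 \/ sym_count [set t in block_trade] a = 0.
Proof.
have [/mapP[q Eq ->]|nEa] := boolP (a \in map s E); [left | right].
  rewrite /sym_count (_ : [set _ in _ | _] = [set (r1 q, c2 q, s q); (r2 q, c1 q, s q)]).
    by rewrite cards2 !xpair_eqE (negPf (r_neq Eq)).
  apply/setP=> t; rewrite !inE; apply/andP/orP.
    case=> /block_tradeP[q' Eq' tE] /eqP ss.
    have qq' : q' = q by apply: s_inj => //; rewrite -ss; case: tE => ->.
    by subst q'; case: tE => ->; [left | right].
  by case=> /eqP ->; split=> //; apply/block_tradeP; exists q => //; [left | right].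
rewrite /sym_count; apply/eqP; rewrite cards_eq0; apply/eqP/setP=> t; rewrite !inE.
apply/negP=> /andP[/block_tradeP[q Eq tE] /eqP ta]; case/negP: nEa.
by rewrite -ta; case: tE => ->; apply: map_f.
Qed.

End BlockTrade.

(** * From a dissection to a trade *)

Lemma count_sum (I : Type) (a : pred I) (l : seq I) : count a l = \sum_(q <- l) a q.
Proof. by rewrite -sum1_count big_mkcond; apply: eq_bigr => q _; case: (a q). Qed.

Lemma inord_inj P : {in gtn P.+1 &, injective (@inord P)}.
Proof. by move=> x y ltx lty /(congr1 val); rewrite /= !inordK. Qed.

(* The outer rectangle contributes the symbol [0 = w + h]. *)
Lemma dissection_trade n w h p :
  dissection n w h -> 0 < w -> 0 < h -> w + h = p ->
  exists T : {set triple p},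
    [/\ latin_trade (Bp p) T, #|T| <= 2 * n.+1 &
        forall s, sym_count T s = 2 \/ sym_count T s = 0].
Proof.
case: p => [|P]; first by lia.
move=> [L [szL tL pL uL bL]] w_gt0 h_gt0 whP.
pose Q : Type := (nat * nat * nat * nat)%type.
pose blk (q : square) : Q := (q.1.1, q.1.1 + q.2, q.1.2, q.1.2 + q.2).
(* A block lists two rows, then two columns. The outer one has its columns in the order [h], [0], so
   that its trade cells are [(0, 0)] and [(w, h)]. *)
pose E : seq Q := (0, w, h, 0) :: map blk L.
pose r1 (q : Q) : 'I_P.+1 := inord q.1.1.1.
pose r2 (q : Q) : 'I_P.+1 := inord q.1.1.2.
pose c1 (q : Q) : 'I_P.+1 := inord q.1.2.
pose c2 (q : Q) : 'I_P.+1 := inord q.2.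
pose s (q : Q) : 'I_P.+1 := inord ((q.1.1.1 + q.2) %% P.+1).
have lt_ad q : q \in L -> antidiag q < P.+1 by move/(allP bL); rewrite whP.
have s_blk q : q \in L -> s (blk q) = inord (antidiag q).
  by move/lt_ad=> lt_q; rewrite /s /= addnA modn_small.
have E_dom q : q \in E -> [/\ q.1.1.1 != q.1.1.2, q.1.2 != q.2,
    [&& q.1.1.1 < P.+1, q.1.1.2 < P.+1, q.1.2 < P.+1 & q.2 < P.+1] &
    q.1.1.2 + q.1.2 = q.1.1.1 + q.2 %[mod P.+1]].
  rewrite inE => /predU1P[->|/mapP[t tL' ->]] /=.
    by split; rewrite ?whP ?modnn ?mod0n //; lia.
  have := lt_ad _ tL'; have /= := allP pL _ tL'; rewrite /antidiag => t_gt0 lt_t.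
  by split; try lia; rewrite addnAC -addnA.
have s_uniq : uniq (map s E).
  have -> : map s E = map inord (0 :: map antidiag L).
    rewrite /= /s mod0n -!map_comp; congr (_ :: _).
    by apply/eq_in_map=> q; apply: s_blk.
  rewrite map_inj_in_uniq; last first.
    by apply: sub_in2 (@inord_inj P) => x; rewrite inE => /predU1P[->|/mapP[q /lt_ad + ->]].
  rewrite /= uL andbT; apply/mapP=> -[q /(allP pL) /=]; rewrite /antidiag; lia.
have r_neq : {in E, forall q, r1 q != r2 q}.
  move=> q /E_dom[ne _ /and4P[lt1 lt2 _ _] _].
  by apply: contra ne => /eqP /inord_inj ->.
have c_neq : {in E, forall q, c1 q != c2 q}.
  move=> q /E_dom[_ ne /and4P[_ _ lt1 lt2] _].
  by apply: contra ne => /eqP /inord_inj ->.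
have block_Bp : {subset block_trade E r1 r2 c1 c2 s <= Bp P.+1}.
  move=> t /block_tradeP[q /E_dom[_ _ /and4P[lt1 lt2 lt3 lt4] mod_q] tE].
  by rewrite inE; case: tE => ->;
     rewrite /tsym /trow /tcol /= !inordK ?ltn_pmod // mod_q.
have same_cells : perm_eq (map tcell (block_trade E r1 r2 c1 c2 s))
                          (map tcell (block_mate E r1 r2 c1 c2 s)).
  (* The multisets agree if every predicate [a] has equal counts on them; [tiles] is tested against
     the indicator of [a]. *)
  apply/permP=> a; pose f x y : nat := a (inord x : 'I_P.+1, inord y : 'I_P.+1).
  rewrite /block_trade /block_mate !map_cat !count_cat -!map_comp !count_map.
  rewrite !count_sum /E !big_cons !big_map /=.
  have := tL f; rewrite /anti_corners /main_corners !big_split /= /f /r1 /r2 /c1 /c2.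
  by rewrite /tcell /=; lia.
exists [set t in block_trade E r1 r2 c1 c2 s]; split.
- exact: block_latin_trade.
- by rewrite (leq_trans (block_card _ _ _ _ _ _)) // leq_mul2l /= size_map ltnS.
- exact: block_sym_count.
Qed.

(** * The logarithmic bound *)

Lemma ln_le x y : (0 < x)%R -> (x <= y)%R -> (ln x <= ln y)%R.
Proof.
move=> x_gt0 [lt_xy | ->]; last exact: Rle_refl.
by apply: Rlt_le; apply: ln_increasing.
Qed.

Lemma pow4_le_ln m p : 1 < p -> 4 ^ m <= p -> (INR m <= ln (INR p))%R.
Proof.
move=> p_gt1 le_p.
have exp_le k : (exp (INR k) <= INR (4 ^ k))%R.
  elim: k => [|k IHk]; first by rewrite exp_0 /=; lra.
  rewrite S_INR exp_plus expnSr mult_INR.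
  apply: Rmult_le_compat => //; try exact: Rlt_le (exp_pos _).
  by have := exp_le_3; rewrite /=; lra.
rewrite -[INR m]ln_exp; apply: ln_le; first exact: exp_pos.
apply: Rle_trans (exp_le m) _; apply: le_INR; exact/leP.
Qed.

Theorem theorem5p1 :
  exists C : R, (0 < C)%R /\
    forall p : nat, prime p ->
      exists T : {set triple p},
        latin_trade (Bp p) T /\
        (INR #|T| <= C * ln (INR p))%R /\
        (forall s : 'I_p, sym_count T s = 2 \/ sym_count T s = 0).
Proof.
(* The size is at most [2 * (9 * m + 29)]; with [m <= ln p] and [1 <= 2 * ln p] this is at most
   [134 * ln p], so [200] leaves room. *)
exists 200%R; split; first lra.
move=> p p_pr; have p_gt1 := prime_gt1 p_pr.
have [m [w [h [le_m wh w_gt0 h_gt0 Dwh]]]] := prime_dissection p_pr.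
have [T [trT cardT symT]] := dissection_trade Dwh w_gt0 h_gt0 wh.
exists T; split=> //; split=> //.
have ln_m := pow4_le_ln p_gt1 le_m.
have ln_half : (1 / 2 <= ln (INR p))%R.
  have le_2p : (2 <= INR p)%R by apply: (le_INR 2); apply/leP.
  by have := ln_lt_2; have := @ln_le 2 (INR p) ltac:(lra) le_2p; lra.
have /leP /le_INR : #|T| <= 18 * m + 58 by lia.
by rewrite plus_INR mult_INR [INR 18]INR_IZR_INZ [INR 58]INR_IZR_INZ /=; lra.
Qed.
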